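(* For every $n\ge 2$ one has $$L_1(n)=V(G_n)\setminus L_{\ge 2}(n),$$ and for every integer $r\ge 2$, $$L_{\ge r}(n)=\{\lambda\vdash n: s(\lambda)\ge r\ \text{ or }\ t(\lambda)\ge r\}.$$ Equivalently, $$L_r(n)=L_{\ge r}(n)\setminus L_{\ge r+1}(n)\qquad (r\ge 2).$$ In particular, $$L_r(n)=\{\lambda\vdash n:\max(1,s(\lambda),t(\lambda))=r\}\qquad (n\ge 2,\ r\ge 1).$$
   Context: For $n\ge 1$, the partition graph $G_n$ is the simple graph whose vertices are the integer partitions of $n$; two distinct partitions are adjacent if one is obtained from the other by an elementary transfer of one unit from one part to another, followed by reordering. The receiving part may be a part equal to $0$ (i.e. the unit may form a new part of size $1$), and a part reduced to $0$ is deleted. $K_n=\mathrm{Cl}(G_n)$ is the clique complex of $G_n$: its simplices are the nonempty cliques of $G_n$, and a clique with $d+1$ vertices is a simplex of dimension $d$. For a vertex $\lambda$ of $G_n$, the local simplex dimension $\dim_{\mathrm{loc}}(\lambda)$ is the maximum of $\dim\sigma$ over all simplices $\sigma$ of $K_n$ containing $\lambda$; equivalently, $\dim_{\mathrm{loc}}(\lambda)=d$ iff the largest clique of $G_n$ containing $\lambda$ has cardinality $d+1$. For $r\ge 0$: $L_r(n)=\{\lambda\in V(G_n):\dim_{\mathrm{loc}}(\lambda)=r\}$ and $L_{\ge r}(n)=\{\lambda\in V(G_n):\dim_{\mathrm{loc}}(\lambda)\ge r\}$. Identify a partition with its Ferrers diagram. $\mathrm{Rem}(\lambda)$ is the set of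 removable corners of $\lambda$ (cells of the diagram whose removal leaves the diagram of a partition) and $\mathrm{Add}(\lambda)$ is the set of addable corners (cells not in the diagram whose addition gives the diagram of a partition). For $c\in\mathrm{Rem}(\lambda)$ and $a\in\mathrm{Add}(\lambda)$, $\lambda(c\to a)$ is the diagram obtained by removing the cell $c$ and adding the cell $a$; the transfer is admissible if the resulting diagram is again the diagram of a partition and is different from $\lambda$. Star and top capacities (for $\lambda\vdash n$, $n\ge 2$): put $A_{\max}(\lambda,c)=\{a\in\mathrm{Add}(\lambda):\lambda(c\to a)\text{ is admissible}\}$ for $c\in\mathrm{Rem}(\lambda)$, and $C_{\max}(\lambda,a)=\{c\in\mathrm{Rem}(\lambda):\lambda(c\to a)\text{ is admissible}\}$ for $a\in\mathrm{Add}(\lambda)$; then $$s(\lambda)=\max_{c\in\mathrm{Rem}(\lambda)}|A_{\max}(\lambda,c)|,\qquad t(\lambda)=\max_{a\in\mathrm{Add}(\lambda)}|C_{\max}(\lambda,a)|.$$ *)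

(* Defs.v *)
From HB Require Import structures.
From mathcomp Require Import all_boot.

Set Implicit Arguments.
Unset Strict Implicit.
Unset Printing Implicit Defensive.

(* Integer partitions: weakly decreasing sequences of positive parts. *)

Definition is_partition (n : nat) (s : seq nat) : bool :=
  [&& sorted geq s, all (ltn 0) s & sumn s == n].

Record intpart (n : nat) : predArgType :=
  IntPart { parts :> seq nat; partsP : is_partition n parts }.

HB.instance Definition _ n := [isSub for @parts n].
HB.instance Definition _ n := [Countable of intpart n by <:].

(* Finiteness: a partition of n has at most n parts, each at most n. *)

Definition intpart_code n (p : intpart n) : n.-bseq 'I_n.+1 :=
  insub_bseq n (map inord p).

Definition intpart_decode n (b : n.-bseq 'I_n.+1) : option (intpart n) :=
  insub (map val b).

Lemma size_le_sumn (s : seq nat) : all (ltn 0) s -> size s <= sumn s.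
Proof.
elim: s => //= x s IHs /andP[x_gt0 /IHs le_s].
by rewrite -add1n leq_add.
Qed.

Lemma mem_le_sumn (s : seq nat) x : x \in s -> x <= sumn s.
Proof.
elim: s => //= y s IHs; rewrite inE => /orP[/eqP->|/IHs le_x].
  exact: leq_addr.
exact: leq_trans le_x (leq_addl _ _).
Qed.

Lemma intpart_codeK n : pcancel (@intpart_code n) (@intpart_decode n).
Proof.
move=> p; rewrite /intpart_code /intpart_decode.
have /and3P[_ pos_p /eqP sum_p] := partsP p.
rewrite /insub_bseq insubdK; last first.
  by rewrite unfold_in /= size_map -[X in _ <= X]sum_p size_le_sumn.
rewrite -map_comp map_id_in ?valK // => x p_x /=.
by rewrite inordK // ltnS -[X in _ <= X]sum_p mem_le_sumn.
Qed.

HB.instance Definition _ n : isFinite (intpart n) :=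
  PCanIsFinite (@intpart_codeK n).

(* The partition graph and its clique complex. *)

(* One unit moves from the part of index i to the part of index j; the index
   j = size s stands for a part equal to 0, which [incr_nth] appends. *)
Definition transfer (s : seq nat) (i j : nat) : seq nat :=
  sort geq [seq x <- incr_nth (set_nth 0 s i (nth 0 s i).-1) j | 0 < x].

Definition is_transfer (s u : seq nat) : bool :=
  [exists i : 'I_(size s), exists j : 'I_(size s).+1,
    ((i : nat) != j) && (u == transfer s i j)].

Definition adj n : rel (intpart n) :=
  fun p q => (p != q) && (is_transfer p q || is_transfer q p).

Definition is_clique n (C : {set intpart n}) : bool :=
  [forall p in C, forall q in C, (p != q) ==> adj p q].

Definition clique_complex n : {set {set intpart n}} :=
  [set C : {set intpart n} | (C != set0) && is_clique C].

Definition simplex_dim n (C : {set intpart n}) : nat := #|C|.-1.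

Definition dim_loc n (p : intpart n) : nat :=
  \max_(C in clique_complex n | p \in C) simplex_dim C.

Definition L (r n : nat) : {set intpart n} := [set p | dim_loc p == r].

Definition Lge (r n : nat) : {set intpart n} := [set p | r <= dim_loc p].

(* Ferrers diagrams. A cell (i, j) lies in row i and column j, counted from 0.
   The diagram of a partition of n, and all its addable corners, lie in the
   square [0, n] x [0, n]. *)

Definition cell (n : nat) : finType := ('I_n.+1 * 'I_n.+1)%type.

Definition ferrers n (s : seq nat) : {set cell n} :=
  [set c : cell n | c.2 < nth 0 s c.1].

(* Requiring a partition of #|D| excludes those whose diagram leaves the
   square and would be truncated by [ferrers n]. *)
Definition is_diagram n (D : {set cell n}) : bool :=
  [exists q : intpart #|D|, D == ferrers n q].

Definition Rem n (p : intpart n) : {set cell n} :=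
  [set c in ferrers n p | is_diagram (ferrers n p :\ c)].

Definition Add n (p : intpart n) : {set cell n} :=
  [set a | (a \notin ferrers n p) && is_diagram (a |: ferrers n p)].

Definition move n (p : intpart n) (c a : cell n) : {set cell n} :=
  a |: (ferrers n p :\ c).

Definition admissible n (p : intpart n) (c a : cell n) : bool :=
  is_diagram (move p c a) && (move p c a != ferrers n p).

Definition Amax n (p : intpart n) (c : cell n) : {set cell n} :=
  [set a in Add p | admissible p c a].

Definition Cmax n (p : intpart n) (a : cell n) : {set cell n} :=
  [set c in Rem p | admissible p c a].

Definition star_cap n (p : intpart n) : nat := \max_(c in Rem p) #|Amax p c|.

Definition top_cap n (p : intpart n) : nat := \max_(a in Add p) #|Cmax p a|.

(* Main.v *)
Require Import Defs.
From mathcomp Require Import all_boot.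

(** Identify a partition with its Ferrers diagram, an order ideal (a downset) of
the grid. Two partitions of [n] are adjacent exactly when their diagrams differ
by one cell, i.e. share [n - 1] cells ([adjE]), so the partition graph is an
induced subgraph of a Johnson graph: transferring a unit between parts changes
the column heights by one cell lost and one cell gained, and conversely the
lost and the gained cell lie in two rows between which a unit is transferred.

A neighbour of [p] is then a move [p(c -> a)], and two neighbours [p(c -> a)] and
[p(d -> b)] are adjacent only if [c = d] or [a = b] ([adj_moves]). As in any Johnson
graph, the members of a clique containing [p] therefore either all contain [p]
minus one fixed cell [c], or are all contained in [p] plus one fixed cell [a]
([clique_in_star_or_top]). Both kinds of family are themselves cliques, and
besides [p] they have [#|Amax p c|], respectively [#|Cmax p a|], members
([card_star], [card_top]): order ideals being closed under intersection and
union, [c] is removable and [a] addable as soon as [p(c -> a)] is a diagram. Hence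
the local dimension of [p] is the larger of its two capacities ([dim_locE]).

All the equalities of the theorem follow, because no vertex is isolated when
[1 < n], so that local dimensions are positive ([dim_loc_gt0]). *)

(** * Weakly decreasing sequences *)

Lemma geq_trans : transitive geq.
Proof. by move=> y x z yx zy; apply: leq_trans zy yx. Qed.

Lemma nth_sorted_geq {s} i j : sorted geq s -> i <= j -> nth 0 s j <= nth 0 s i.
Proof.
have [js|/(nth_default 0)-> //] := ltnP j (size s) => s_sorted le_ij.
by apply: (sorted_leq_nth geq_trans leqnn) => //; apply: leq_ltn_trans js.
Qed.

(** Conjugation: entry [j] of the conjugate of [s] is [count (ltn j) s]. Column
heights, unlike rows, do not change when the entries are reordered, which makes
the sorting step of a transfer invisible to them. *)
Lemma ltn_nth_count s i j : sorted geq s -> (j < nth 0 s i) = (i < count (ltn j) s).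
Proof.
elim: s i => [|x s IHs] i /=; first by rewrite nth_nil.
move=> xs; have s_sorted := path_sorted xs.
have [j_lt|x_le] := ltnP j x; first by case: i => //= i; rewrite IHs.
suff -> : count (ltn j) s = 0.
  case: i => [|i] /=; first by rewrite ltnNge x_le.
  apply/negbTE; rewrite -leqNgt (leq_trans _ x_le) //.
  exact: (@nth_sorted_geq (x :: s) 0 i.+1).
apply/eqP; rewrite -leqn0 leqNgt -has_count; apply/hasPn => y ys /=.
rewrite -leqNgt (leq_trans _ x_le) //.
by have /allP/(_ y ys) := order_path_min geq_trans xs.
Qed.

Lemma nth_filter_pos s i : sorted geq s -> nth 0 [seq x <- s | 0 < x] i = nth 0 s i.
Proof.
elim: s i => //= x s IHs i xs; have s_sorted := path_sorted xs.
have [x0|x_gt0] := posnP x; last by case: i => //= i; apply: IHs.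
rewrite IHs //; rewrite x0 in xs.
have zero k : nth 0 (0 :: s) k = 0.
  by apply/eqP; rewrite -leqn0; apply: (@nth_sorted_geq (0 :: s) 0 k).
by rewrite x0 zero; apply: (zero i.+1).
Qed.

(** Rebuilds a partition from its rows, which may have been padded with zeros. *)
Lemma filter_pos_eq u v :
  all (ltn 0) v -> nth 0 u =1 nth 0 v -> [seq x <- u | 0 < x] = v.
Proof.
elim: u v => [|x u IHu] [|y v] //=.
- by move=> /andP[y0 _] /(_ 0) /= y_0; rewrite -y_0 in y0.
- move=> _ nth0; have /= -> := nth0 0.
  by apply: IHu => // i; have /= -> := nth0 i.+1; rewrite nth_nil.
- move=> /andP[y0 v_pos] eq_nth; have /= -> := eq_nth 0.
  by rewrite y0 (IHu v) // => i; apply: (eq_nth i.+1).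
Qed.

Lemma sum_nth s m : size s <= m -> \sum_(i < m) nth 0 s i = sumn s.
Proof.
elim: s m => [|x s IHs] m /=; first by move=> _; rewrite big1 // => i _; rewrite nth_nil.
by case: m => // m /IHs <-; rewrite big_ord_recl.
Qed.

Lemma sumn_filter_pos s : sumn [seq x <- s | 0 < x] = sumn s.
Proof. by elim: s => //= -[|x] s /= ->. Qed.

Lemma count_incr_nth k s j :
  count (ltn k) (incr_nth s j) = count (ltn k) s + (k == nth 0 s j).
Proof.
elim: s j => [|x s IHs] [|j] /=.
- by rewrite ltnS leqn0 addn0.
- by elim: j => [|j /= ->] //=; rewrite ltnS leqn0 addn0.
- by rewrite ltnS leq_eqVlt addnAC; case: eqP => [->|]; rewrite ?ltnn ?addn0.
- by rewrite IHs addnA.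
Qed.

(** A transfer takes one cell out of column [(nth 0 s i).-1] and puts one into
column [nth 0 s j]. The equation is additive on both sides because the two
columns may coincide, and because subtraction truncates. *)
Lemma count_transfer k s i j : i < size s -> i != j -> 0 < nth 0 s i ->
  count (ltn k) (transfer s i j) + (k == (nth 0 s i).-1)
    = count (ltn k) s + (k == nth 0 s j).
Proof.
move=> i_lt neq_ij s_i; rewrite /transfer count_sort count_filter.
rewrite (@eq_count _ _ (ltn k)); last first.
  by move=> x /=; case: x => //= x; rewrite andbT.
set v := set_nth 0 s i _.
have defs : incr_nth v i = s.
  have sz : size (incr_nth v i) = size s.
    by rewrite size_incr_nth size_set_nth (maxn_idPr i_lt) i_lt.
  apply: (@eq_from_nth _ 0) => // m _.
  rewrite nth_incr_nth nth_set_nth /= eq_sym.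
  by case: eqP => [->|//]; rewrite add1n prednK.
(* The decrement is undone by an increment at the same index, so the rule for
   [incr_nth] covers both halves of the transfer. *)
have -> : count (ltn k) s = count (ltn k) v + (k == nth 0 v i).
  by rewrite -count_incr_nth defs.
rewrite count_incr_nth !nth_set_nth /= eqxx [j == i]eq_sym (negPf neq_ij).
by rewrite addnAC.
Qed.

(** * Partitions *)

Lemma card_ord_lt m k : k <= m -> #|[set j : 'I_m | j < k]| = k.
Proof.
by move=> k_le; rewrite cardsE -sum1_card -(big_ord_widen _ (fun=> 1)) // sum1_card card_ord.
Qed.

Section IntParts.

Context {n : nat}.
Implicit Types p q : intpart n.

Lemma intpart_sorted p : sorted geq p.
Proof. by case/and3P: (partsP p). Qed.

Lemma intpart_pos p : all (ltn 0) p.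
Proof. by case/and3P: (partsP p). Qed.

Lemma sumn_intpart p : sumn p = n.
Proof. by case/and3P: (partsP p) => _ _ /eqP. Qed.

Lemma size_intpart p : size p <= n.
Proof. by rewrite -[X in _ <= X](sumn_intpart p) size_le_sumn ?intpart_pos. Qed.

Lemma nth_intpart_le p i : nth 0 p i <= n.
Proof.
have [i_lt|/(nth_default 0)-> //] := ltnP i (size p).
by rewrite -[X in _ <= X](sumn_intpart p) mem_le_sumn ?mem_nth.
Qed.

Lemma intpart_nth_inj p q : nth 0 p =1 nth 0 q -> p = q.
Proof.
move=> eq_nth; apply: val_inj; rewrite /= -(filter_pos_eq p q) ?intpart_pos //.
by apply/esym/all_filterP/intpart_pos.
Qed.

End IntParts.

(** * Diagrams as order ideals *)

Section Diagrams.

Context {n : nat}.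
Implicit Types (p q r : intpart n) (D E : {set cell n}) (c a x y : cell n).

Definition downset D :=
  forall x y, x \in D -> y.1 <= x.1 -> y.2 <= x.2 -> y \in D.

Lemma sum_row D (i : 'I_n.+1) :
  \sum_(x in D) (x.1 == i :> nat) = #|[set j | (i, j) \in D]|.
Proof.
rewrite -(@card_imset _ _ (pair i)) => [|j k [] //]; rewrite -sum1_card.
transitivity (\sum_(x in D | x.1 == i) 1); first by rewrite big_mkcondr.
apply: eq_bigl => -[k j] /=; apply/andP/imsetP => [[kjD /eqP<-]|[l]].
  by exists j; rewrite ?inE.
by rewrite inE => ilD [-> ->]; rewrite ilD.
Qed.

Lemma sum_rows D :
  \sum_(i < n.+1) \sum_(x in D) (x.1 == i :> nat) = #|D|.
Proof.
rewrite exchange_big -sum1_card /=; apply: eq_bigr => x _.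
rewrite (bigD1 x.1) //= eqxx big1 // => i neq_i.
by rewrite (_ : (_ == _ :> nat) = false) //; apply/negbTE; rewrite eq_sym.
Qed.

Lemma ferrers_row p i : \sum_(x in ferrers n p) (x.1 == i :> nat) = nth 0 p i.
Proof.
have [i_le|n_lt] := leqP i n; last first.
  rewrite nth_default ?(leq_trans (size_intpart p)) 1?ltnW // big1 // => x _.
  by rewrite ltn_eqF // (leq_trans (ltn_ord x.1)).
rewrite -ltnS in i_le; rewrite (sum_row _ (Ordinal i_le)).
rewrite -[RHS](@card_ord_lt n.+1) ?(leq_trans (nth_intpart_le p i)) //.
by apply: eq_card => j; rewrite !inE.
Qed.

Lemma card_ferrers p : #|ferrers n p| = n.
Proof.
rewrite -sum_rows (eq_bigr (fun i : 'I_n.+1 => nth 0 p i)); last first.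
  by move=> i _; apply: ferrers_row.
by rewrite sum_nth ?sumn_intpart // leqW // size_intpart.
Qed.

Lemma ferrers_inj : injective (fun p => ferrers n p).
Proof.
by move=> p q eq_F; apply: intpart_nth_inj => i; rewrite -!ferrers_row eq_F.
Qed.

(** A row of a downset is an initial segment, hence determined by its length. *)
Lemma mem_downset_row D (i j : 'I_n.+1) : downset D ->
  ((i, j) \in D) = (j < \sum_(x in D) (x.1 == i :> nat)).
Proof.
move=> D_down; rewrite sum_row; set R := [set _ | _]; apply/idP/idP => [ijD|].
  rewrite -[X in X <= _](@card_ord_lt n.+1 j.+1) ?subset_leq_card //.
  by apply/subsetP => k; rewrite !inE ltnS => le_kj; apply: D_down ijD _ _.
apply: contraLR => ijD; rewrite -leqNgt -[X in _ <= X](@card_ord_lt n.+1 j (ltnW (ltn_ord j))).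
apply: subset_leq_card; apply/subsetP => k; rewrite !inE => ikD.
by rewrite ltnNge; apply: contra ijD => le_jk; apply: D_down ikD _ _.
Qed.

(** Diagrams are exactly the downsets; this is what makes them closed under
unions and intersections. Conversely, a downset is the diagram of the sequence
of its row lengths. *)
Lemma is_diagramP D : reflect (downset D) (is_diagram D).
Proof.
apply: (iffP existsP) => [[q /eqP->] x y|D_down].
  rewrite !inE => x_lt le1 le2; apply: leq_ltn_trans le2 (leq_trans x_lt _).
  by apply: nth_sorted_geq => //; apply: intpart_sorted.
pose row i := \sum_(x in D) (x.1 == i :> nat).
have row_anti i j : i <= j -> row j <= row i.
  have [j_lt le_ij|n_lt _] := ltnP j n.+1; last first.
    by rewrite [row j]big1 // => x _; rewrite ltn_eqF // (leq_trans (ltn_ord x.1)).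
  have i_lt := leq_ltn_trans le_ij j_lt.
  rewrite /row (sum_row _ (Ordinal j_lt)) (sum_row _ (Ordinal i_lt)).
  apply/subset_leq_card/subsetP => k; rewrite !inE => jkD.
  exact: D_down jkD _ _.
pose s := mkseq row n.+1.
have s_sorted : sorted geq s.
  apply/(sortedP 0) => i; rewrite size_mkseq => i_lt.
  by rewrite !nth_mkseq ?(ltnW i_lt) //= row_anti.
have nth_s i : nth 0 s i = row i.
  have [i_lt|n_lt] := ltnP i n.+1; first by rewrite nth_mkseq.
  rewrite nth_default ?size_mkseq // /row big1 // => x _.
  by rewrite ltn_eqF // (leq_trans (ltn_ord x.1)).
have q_part : is_partition #|D| [seq x <- s | 0 < x].
  apply/and3P; split; [exact/sorted_filter/s_sorted/geq_trans | exact: filter_all |].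
  rewrite sumn_filter_pos -(@sum_nth _ n.+1) ?size_mkseq //.
  by rewrite -sum_rows; apply/eqP/eq_bigr => i _; apply: nth_s.
have nth_q i : nth 0 (IntPart q_part) i = row i.
  by rewrite -nth_s; apply: nth_filter_pos.
exists (IntPart q_part); apply/eqP/setP => -[i j].
by rewrite inE nth_q; apply: mem_downset_row.
Qed.

(** Transports a diagram from partitions of [#|D|] to partitions of [m]. *)
Lemma diagram_intpart D m : #|D| = m -> is_diagram D -> exists q : intpart m, D = ferrers n q.
Proof. by move=> <- /existsP[q /eqP]; exists q. Qed.

Lemma downsetI D E : downset D -> downset E -> downset (D :&: E).
Proof.
move=> Dd Ed x y /setIP[xD xE] le1 le2.
by rewrite inE; apply/andP; split; [apply: (Dd x) | apply: (Ed x)].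
Qed.

Lemma downsetU D E : downset D -> downset E -> downset (D :|: E).
Proof.
move=> Dd Ed x y /setUP[] xD le1 le2; rewrite inE; apply/orP.
  by left; apply: (Dd x).
by right; apply: (Ed x).
Qed.

Lemma downset_ferrers p : downset (ferrers n p).
Proof.
move=> x y; rewrite !inE => x_lt le1 le2; apply: leq_ltn_trans le2 (leq_trans x_lt _).
exact: nth_sorted_geq (intpart_sorted p) le1.
Qed.

Lemma ferrers_exists D : downset D -> #|D| = n -> exists q, ferrers n q = D.
Proof.
by move=> /is_diagramP D_diag /diagram_intpart/(_ D_diag)[q ->]; exists q.
Qed.

(** * Adjacency as the exchange of one cell *)

Lemma card_ferrersD p q : #|ferrers n p :\: ferrers n q| = #|ferrers n q :\: ferrers n p|.
Proof. by rewrite !cardsD !card_ferrers setIC. Qed.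

(** Two diagrams of the same size that differ by one cell on one side differ by
one cell on the other side too. *)
Lemma moveP p q : reflect
  (exists c a, [/\ c \in ferrers n p, a \notin ferrers n p & ferrers n q = move p c a])
  (#|ferrers n p :\: ferrers n q| == 1).
Proof.
apply: (iffP idP) => [pq|[c [a [cp ap defq]]]].
  have /cards1P[a defa] : #|ferrers n q :\: ferrers n p| == 1 by rewrite -card_ferrersD.
  have /cards1P[c defc] := pq.
  exists c, a; split.
  - by have := set11 c; rewrite -defc => /setDP[].
  - by have := set11 a; rewrite -defa => /setDP[].
  apply/setP => x; have /setP/(_ x) := defa; have /setP/(_ x) := defc.
  rewrite !inE => <- <-.
  by case: (_ < _); case: (_ < _).
rewrite defq; apply/cards1P; exists c; apply/setP => x; rewrite in_setD in_setU1.
rewrite in_setD1 in_set1; have [->|neq_xc] := eqVneq x c.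
  by rewrite cp orbF andbT; apply: contraNneq ap => <-.
by case: (x \in ferrers n p); rewrite ?orbT ?andbF.
Qed.

(** With [f] the indicator of a row, this compares the parts of [p] and of the
partition obtained by moving a cell. *)
Lemma sum_move p c a (f : cell n -> nat) : c \in ferrers n p -> a \notin ferrers n p ->
  \sum_(x in move p c a) f x + f c = \sum_(x in ferrers n p) f x + f a.
Proof.
move=> cp ap; rewrite big_setU1 ?(big_setD1 c cp) /=; first by rewrite addnC addnA [in RHS]addnAC.
by rewrite in_setD1 (negPf ap) andbF.
Qed.

Lemma is_transfer_move p q c a : c \in ferrers n p -> a \notin ferrers n p ->
  ferrers n q = move p c a -> is_transfer p q.
Proof.
move=> cp ap defq.
have rows i : nth 0 q i + (c.1 == i :> nat) = nth 0 p i + (a.1 == i :> nat).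
  by rewrite -!ferrers_row defq sum_move.
(* Losing and gaining a cell in the same row would leave every part unchanged. *)
have neq_ca : c.1 != a.1 :> nat.
  apply: contraNneq ap => eq_ca; rewrite (@intpart_nth_inj _ p q) ?defq ?setU11 //.
  by move=> i; apply: (@addIn (c.1 == i :> nat)); rewrite rows eq_ca.
have c_row : 0 < nth 0 p c.1 by move: cp; rewrite inE; apply: leq_ltn_trans.
have c_lt : c.1 < size p.
  by rewrite ltnNge; apply: contraL c_row => /(nth_default 0)->.
have a_le : a.1 <= size p.
  rewrite leqNgt; apply/negP => lt_a.
  (* Otherwise row [size p] of [q] would be empty, yet row [a.1] below it not. *)
  have := @nth_sorted_geq _ (size p) a.1 (intpart_sorted q) (ltnW lt_a).
  have := rows (size p); have := rows a.1.
  rewrite eqxx (negPf neq_ca) (ltn_eqF c_lt) (gtn_eqF lt_a) !addn0.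
  by rewrite (nth_default 0 (ltnW lt_a)) (nth_default 0 (leqnn _)) => -> ->.
apply/existsP; exists (Ordinal c_lt); apply/existsP; exists (inord a.1).
rewrite /= inordK // neq_ca; apply/eqP/esym; rewrite /transfer.
rewrite (@filter_pos_eq _ q) ?intpart_pos //.
  by apply: sorted_sort (intpart_sorted q); apply: geq_trans.
move=> i; apply: (@addIn (c.1 == i :> nat)); rewrite rows nth_incr_nth nth_set_nth /=.
have [->|neq_ic] := eqVneq i (c.1 : nat); last first.
  by rewrite addn0 addnC.
by rewrite eq_sym (negPf neq_ca) addn0 addn1 prednK.
Qed.

(** By [count_transfer] at most one column gets shorter, and then by one cell only. *)
Lemma is_transfer_card p q : is_transfer p q -> #|ferrers n p :\: ferrers n q| <= 1.
Proof.
case/existsP => i /existsP[j /andP[neq_ij /eqP defq]].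
have i_pos : 0 < nth 0 p i by have /(all_nthP 0)/(_ i (ltn_ord i)) := intpart_pos p.
have cols k : count (ltn k) q + (k == (nth 0 p i).-1) = count (ltn k) p + (k == nth 0 p j).
  by rewrite defq count_transfer.
(* This pins down both coordinates of a lost cell. *)
have lost x : x \in ferrers n p :\: ferrers n q ->
    x.2 = (nth 0 p i).-1 :> nat /\ x.1 = count (ltn x.2) q :> nat.
  rewrite !inE !ltn_nth_count ?intpart_sorted // -leqNgt => /andP[le_q lt_p].
  have := cols x.2; case: eqP => [eq_x|_] eq_count; last first.
    have := leq_trans lt_p (leq_addr (x.2 == nth 0 p j :> nat) _).
    by rewrite -eq_count addn0 ltnNge le_q.
  split=> //; apply/eqP; rewrite eqn_leq le_q andbT -ltnS -[X in _ < X]addn1 eq_count.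
  exact: leq_trans lt_p (leq_addr _ _).
apply/card_le1_eqP => x y /lost[x2 x1] /lost[y2 y1].
have eq2 : x.2 = y.2 by apply: val_inj; rewrite /= x2.
by rewrite [x]surjective_pairing [y]surjective_pairing eq2; congr (_, _);
   apply: val_inj; rewrite /= x1 eq2.
Qed.

Lemma card_ferrersD_gt0 p q : p != q -> 0 < #|ferrers n p :\: ferrers n q|.
Proof.
apply: contraNltn; rewrite leqn0 cards_eq0 setD_eq0 => sub_pq.
by apply/eqP/ferrers_inj/eqP; rewrite eqEcard sub_pq !card_ferrers /=.
Qed.

(** Adjacency is that of the Johnson graph on [n]-element sets of cells. *)
Lemma adjE p q : adj p q = (#|ferrers n p :\: ferrers n q| == 1).
Proof.
apply/andP/idP => [[neq_pq pq]|/[dup] pq /moveP[c [a [cp ap defq]]]].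
  rewrite eqn_leq card_ferrersD_gt0 // andbT.
  by case/orP: pq => /is_transfer_card //; rewrite card_ferrersD.
split; last by rewrite (is_transfer_move _ _ _ _ cp ap defq).
by apply: contraTneq pq => ->; rewrite setDv cards0.
Qed.

(** * Cliques *)

Lemma move_inj_r p c : {in ~: ferrers n p &, injective (move p c)}.
Proof.
move=> a b; rewrite in_setC => ap _ /setP/(_ a).
by rewrite !in_setU1 in_setD1 (negPf ap) andbF eqxx !orbF => /esym/eqP.
Qed.

Lemma move_inj_l p a : a \notin ferrers n p ->
  {in ferrers n p &, injective (fun c => move p c a)}.
Proof.
move=> ap c d cp _ /setP/(_ c).
rewrite !in_setU1 !in_setD1 cp eqxx andbT /= orbF => eq_d.
have neq_ca : c != a by apply: contraNneq ap => <-.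
by move: eq_d; rewrite (negPf neq_ca) /= andbT => /esym/negbFE/eqP.
Qed.

(** As soon as the outcome of a move is a diagram, the removed cell is a
removable corner and the added one an addable corner: [p] without [c] and [p]
with [a] are the intersection and the union of the two diagrams. *)
Lemma move_admissible p q c a : c \in ferrers n p -> a \notin ferrers n p ->
  ferrers n q = move p c a -> [/\ c \in Rem p, a \in Add p & admissible p c a].
Proof.
move=> cp ap defq; have neq_ca : c != a by apply: contraNneq ap => <-.
split; first 1 last.
- rewrite in_set ap; apply/is_diagramP.
  have -> : a |: ferrers n p = ferrers n p :|: ferrers n q.
    apply/setP => x; rewrite defq !in_setU !in_setD1 !in_set1.
    by case: (x \in ferrers n p); case: (x == a); case: (x == c).
  by apply: downsetU; apply: downset_ferrers.
- rewrite /admissible -defq; apply/andP; split; first exact/is_diagramP/downset_ferrers.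
  by apply: contraNneq ap => <-; rewrite defq setU11.
rewrite in_set cp; apply/is_diagramP.
have -> : ferrers n p :\ c = ferrers n p :&: ferrers n q.
  apply/setP => x; rewrite defq in_setI in_setU1 in_setD1.
  case: (eqVneq x a) => [->|_]; first by rewrite (negPf ap) andbF.
  by case: (x \in ferrers n p); rewrite ?andbF ?andbT.
by apply: downsetI; apply: downset_ferrers.
Qed.

Lemma admissible_move p c a : c \in ferrers n p -> a \notin ferrers n p ->
  admissible p c a -> exists q, ferrers n q = move p c a.
Proof.
move=> cp ap /andP[/is_diagramP move_down _]; apply: ferrers_exists => //.
rewrite -[RHS](card_ferrers p) (cardsD1 c (ferrers n p)) cp cardsU1.
by rewrite in_setD1 (negPf ap) andbF.
Qed.

Definition star p c : {set intpart n} := [set q : intpart n | ferrers n p :\ c \subset ferrers n q].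
Definition top p a : {set intpart n} := [set q : intpart n | ferrers n q \subset a |: ferrers n p].

Lemma is_cliqueP {C : {set intpart n}} :
  reflect {in C &, forall q r, q != r -> adj q r} (is_clique C).
Proof.
apply: (iffP 'forall_implyP) => [C_clique q r qC rC neq_qr|C_clique q qC].
  by have /'forall_implyP/(_ r rC)/implyP := C_clique q qC; apply.
by apply/'forall_implyP => r rC; apply/implyP; apply: C_clique.
Qed.

(** Members of a star share [n - 1] cells; dually, members of a top lie in a common
set of [n + 1] cells. *)
Lemma star_clique p c : c \in ferrers n p -> is_clique (star p c).
Proof.
move=> cp; apply/is_cliqueP => q r; rewrite !in_set => pq pr neq_qr.
rewrite adjE eqn_leq card_ferrersD_gt0 // andbT.
rewrite cardsD card_ferrers leq_subLR -[X in X <= _](card_ferrers p).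
rewrite (cardsD1 c) cp addnC leq_add2r subset_leq_card //.
by rewrite subsetI pq pr.
Qed.

Lemma top_clique p a : is_clique (top p a).
Proof.
apply/is_cliqueP => q r; rewrite !in_set => qp rp neq_qr.
rewrite adjE eqn_leq card_ferrersD_gt0 // andbT.
apply: leq_trans (subset_leq_card (setSD _ qp)) _.
rewrite cardsDS // card_ferrers leq_subLR cardsU1 card_ferrers addnC leq_add2l.
by case: (a \notin _).
Qed.

Lemma center_star p c : p \in star p c.
Proof. by rewrite in_set subD1set. Qed.

Lemma center_top p a : p \in top p a.
Proof. by rewrite in_set subsetU1. Qed.

(** A neighbour [p(d -> a)] lies in the star of [c] only if [d = c]; so the star, its
centre apart, consists of the moves of [c]. *)
Lemma card_star p c : c \in Rem p -> #|star p c :\ p| = #|Amax p c|.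
Proof.
move=> /setIdP[cp _]; rewrite -(card_imset _ ferrers_inj).
rewrite -(@card_in_imset _ _ (move p c)); last first.
  move=> a b /setIdP[/setIdP[ap _] _] /setIdP[/setIdP[bp _] _].
  by apply: move_inj_r; rewrite in_setC.
apply: eq_card => D; apply/imsetP/imsetP => [[q /setD1P[neq_qp qS] ->]|[a]].
  have := is_cliqueP (star_clique p c cp) p q (center_star p c) qS.
  rewrite eq_sym adjE => /(_ neq_qp)/moveP[d [a [dp ap defq]]].
  have eq_dc : d = c.
    apply: contraTeq qS => neq_dc; rewrite in_set; apply/subsetPn; exists d.
      by rewrite in_setD1 neq_dc.
    rewrite defq in_setU1 in_setD1 eqxx orbF.
    by apply: contraNneq ap => <-.
  rewrite -eq_dc; exists a => //.
  by have [_ aA pda] := move_admissible p q d a dp ap defq; rewrite in_set aA.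
case/setIdP=> /setIdP[ap _] pca ->.
have [q defq] := admissible_move p c a cp ap pca; exists q => //.
rewrite in_setD1 in_set defq subsetU1 andbT.
by apply: contraNneq ap => <-; rewrite defq setU11.
Qed.

(** A neighbour [p(c -> b)] lies in the top of [a] only if [b = a]. *)
Lemma card_top p a : a \in Add p -> #|top p a :\ p| = #|Cmax p a|.
Proof.
move=> /setIdP[ap _]; rewrite -(card_imset _ ferrers_inj).
rewrite -(@card_in_imset _ _ (fun c => move p c a)); last first.
  by move=> c d /setIdP[/setIdP[cp _] _] /setIdP[/setIdP[dp _] _]; apply: move_inj_l.
apply: eq_card => D; apply/imsetP/imsetP => [[q /setD1P[neq_qp qT] ->]|[c]].
  have := is_cliqueP (top_clique p a) p q (center_top p a) qT.
  rewrite eq_sym adjE => /(_ neq_qp)/moveP[c [b [cp bp defq]]].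
  have eq_ba : b = a.
    apply: contraTeq qT => neq_ba; rewrite in_set; apply/subsetPn; exists b.
      by rewrite defq setU11.
    by rewrite in_setU1 negb_or neq_ba.
  rewrite -eq_ba; exists c => //.
  by have [cR _ pcb] := move_admissible p q c b cp bp defq; rewrite in_set cR.
case/setIdP=> /setIdP[cp _] pca ->.
have [q defq] := admissible_move p c a cp ap pca; exists q => //.
rewrite in_setD1 in_set defq setUS ?subD1set // andbT.
by apply: contraNneq ap => <-; rewrite defq setU11.
Qed.

Lemma clique_dim_le p (C : {set intpart n}) : p \in C -> is_clique C ->
  simplex_dim C <= dim_loc p.
Proof.
move=> pC C_clique; rewrite /dim_loc.
apply: (@leq_bigmax_cond _ (fun C => (C \in clique_complex n) && (p \in C))).
by rewrite in_set C_clique pC andbT andbT; apply/set0Pn; exists p.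
Qed.

Lemma simplex_dimD1 p (C : {set intpart n}) : p \in C -> simplex_dim C = #|C :\ p|.
Proof. by move=> pC; rewrite /simplex_dim (cardsD1 p) pC. Qed.

Lemma star_cap_le_dim p : star_cap p <= dim_loc p.
Proof.
apply/bigmax_leqP => c cR; rewrite -card_star // -simplex_dimD1 ?center_star //.
by apply: clique_dim_le (center_star p c) (star_clique p c _); case/setIdP: cR.
Qed.

Lemma top_cap_le_dim p : top_cap p <= dim_loc p.
Proof.
apply/bigmax_leqP => a aA; rewrite -card_top // -simplex_dimD1 ?center_top //.
by apply: clique_dim_le (center_top p a) (top_clique p a).
Qed.

(** If both the removed and the added cells differ, [p(c -> a)] contains [a] and [d]
while [p(d -> b)] contains neither. *)
Lemma adj_moves p q r c a d b :
  c \in ferrers n p -> a \notin ferrers n p -> ferrers n q = move p c a ->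
  d \in ferrers n p -> b \notin ferrers n p -> ferrers n r = move p d b ->
  adj q r -> (c == d) || (a == b).
Proof.
move=> cp ap defq dp bp defr; rewrite adjE; apply: contraTT.
rewrite negb_or => /andP[neq_cd neq_ab]; rewrite neq_ltn; apply/orP; right.
apply/card_gt1P; exists d, a.
have neq_da : d != a by apply: contraNneq ap => <-.
have neq_db : d != b by apply: contraNneq bp => <-.
split=> //; rewrite in_setD defq defr !in_setU1 !in_setD1.
  by rewrite dp (negPf neq_db) eqxx [d == c]eq_sym neq_cd orbT.
by rewrite (negPf neq_ab) (negPf ap) andbF eqxx.
Qed.

(** Seen as pairs (removed cell, added cell), the neighbours of [p] in a clique
pairwise agree in a coordinate. Compare one of them, [(c, a)], with one that
leaves the star of [c] and one that leaves the top of [a]: they are [(d, a)] and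
[(c, f)] with [d != c] and [f != a], which agree in no coordinate. *)
Lemma clique_in_star_or_top p (C : {set intpart n}) : p \in C -> is_clique C ->
  [\/ C \subset [set p], exists2 c, c \in Rem p & C \subset star p c
    | exists2 a, a \in Add p & C \subset top p a].
Proof.
move=> pC C_clique.
have movesC q : q \in C -> q != p ->
    exists c a, [/\ c \in ferrers n p, a \notin ferrers n p & ferrers n q = move p c a].
  by move=> qC neq_qp; apply/moveP; rewrite -adjE (is_cliqueP C_clique) // eq_sym.
have [|/subsetPn[q qC]] := boolP (C \subset [set p]); first by constructor 1.
rewrite in_set1 => neq_qp; have [c [a [cp ap defq]]] := movesC q qC neq_qp.
have [cR aA _] := move_admissible p q c a cp ap defq.
have [|/subsetPn[r rC r_star]] := boolP (C \subset star p c).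
  by constructor 2; exists c.
have [|/subsetPn[t tC t_top]] := boolP (C \subset top p a).
  by constructor 3; exists a.
have neq_rp : r != p by apply: contraNneq r_star => ->; apply: center_star.
have neq_tp : t != p by apply: contraNneq t_top => ->; apply: center_top.
have [d [b [dp bp defr]]] := movesC r rC neq_rp.
have [e [f [ep fp deft]]] := movesC t tC neq_tp.
have neq_cd : c != d.
  by apply: contraNneq r_star => ->; rewrite in_set defr subsetU1.
have neq_af : a != f.
  by apply: contraNneq t_top => ->; rewrite in_set deft setUS // subD1set.
have adjC := is_cliqueP C_clique.
have neq_qr : q != r.
  by apply: contraNneq r_star => <-; rewrite in_set defq subsetU1.
have neq_qt : q != t.
  by apply: contraNneq t_top => <-; rewrite in_set defq setUS // subD1set.
have /= := adj_moves p q r c a d b cp ap defq dp bp defr (adjC q r qC rC neq_qr).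
rewrite (negPf neq_cd) /= => /eqP eq_ab.
have := adj_moves p q t c a e f cp ap defq ep fp deft (adjC q t qC tC neq_qt).
rewrite (negPf neq_af) orbF => /eqP eq_ce.
have neq_rt : r != t.
  by apply: contraNneq r_star => ->; rewrite in_set deft eq_ce subsetU1.
have := adj_moves p r t d b e f dp bp defr ep fp deft (adjC r t rC tC neq_rt).
by rewrite -eq_ab -eq_ce eq_sym (negPf neq_cd) (negPf neq_af).
Qed.

Lemma dim_locE p : dim_loc p = maxn (star_cap p) (top_cap p).
Proof.
apply/eqP; rewrite eqn_leq geq_max star_cap_le_dim top_cap_le_dim !andbT.
apply/bigmax_leqP => C /andP[/setIdP[_ C_clique] pC].
rewrite (simplex_dimD1 p) // leq_max.
have [sub|[c cR]|[a aA]] := clique_in_star_or_top p C pC C_clique.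
- by move: sub; rewrite -setD_eq0 -cards_eq0 => /eqP->.
- move=> /(setSD [set p])/subset_leq_card; rewrite card_star // => le_C.
  by rewrite (leq_trans le_C) // (leq_bigmax_cond c).
move=> /(setSD [set p])/subset_leq_card; rewrite card_top // => le_C.
by rewrite orbC (leq_trans le_C) // (leq_bigmax_cond a).
Qed.

(** A cell [c] of [p] maximal for the sum of its coordinates is a removable corner.
It can be moved to the end of the first row, unless it lies in that row, or to
the bottom of the first column, unless it lies in that column; both exceptions
occur together only if [p] is a single cell. *)
Lemma exists_adj p : 1 < n -> exists q, adj p q.
Proof.
move=> n_gt1.
have /card_gt0P[c0 c0p] : 0 < #|ferrers n p| by rewrite card_ferrers ltnW.
pose c := [arg max_(x > c0 in ferrers n p) (x.1 + x.2)].
have [cp c_max] : c \in ferrers n p /\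
    forall x, x \in ferrers n p -> x.1 + x.2 <= c.1 + c.2.
  by rewrite /c; case: arg_maxnP.
suff [a [ap a_min a_c]] : exists a, [/\ a \notin ferrers n p,
    forall y, y.1 <= a.1 -> y.2 <= a.2 -> y != a -> y \in ferrers n p
    & ~~ ((c.1 <= a.1) && (c.2 <= a.2))].
  (* It suffices that [a] is addable to [p] and that [c] does not support [a]. *)
  have [||q defq] := ferrers_exists (move p c a).
  - move=> x y; rewrite !in_setU1 !in_setD1 => /predU1P[->|/andP[neq_xc xp]] le1 le2.
      have [//|neq_ya] := eqVneq y a; rewrite a_min // andbT.
      by apply: contraNneq a_c => <-; rewrite le1 le2.
    rewrite (downset_ferrers p x y) // andbT; apply/orP; right.
    apply: contraNneq neq_xc => eq_yc; rewrite eq_yc in le1 le2.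
    (* [c] itself cannot be below a remaining cell [x]: this would contradict
       the maximality of its coordinate sum, unless [x = c]. *)
    have := c_max x xp; move: le1 le2; rewrite leq_eqVlt => /orP[/eqP/val_inj eq1|lt1].
      rewrite leq_eqVlt => /orP[/eqP/val_inj eq2 _|lt2].
        by apply/eqP; rewrite [x]surjective_pairing -eq1 -eq2 -surjective_pairing.
      by rewrite leqNgt eq1 ltn_add2l lt2.
    by move=> le2; rewrite leqNgt -addSn leq_add.
  - rewrite -[RHS](card_ferrers p) (cardsD1 c (ferrers n p)) cp cardsU1.
    by rewrite in_setD1 (negPf ap) andbF.
  by exists q; rewrite adjE; apply/moveP; exists c, a.
have [c1|c1] := posnP c.1; last first.
  exists (ord0, inord (nth 0 p 0)); rewrite in_set /= inordK ?ltnS ?nth_intpart_le //.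
  rewrite ltnn negb_and -!ltnNge c1; split=> // -[i j] /=.
  rewrite leqn0 => /eqP/(@val_inj _ _ _ i ord0)-> le_j neq_j.
  rewrite in_set /= ltn_neqAle le_j andbT; apply: contraNneq neq_j => eq_j.
  by apply/eqP; congr (_, _); apply: val_inj; rewrite /= inordK -?eq_j.
have c2 : 0 < c.2.
  rewrite lt0n; apply/eqP => c2; have : #|ferrers n p| <= #|[set c]|.
    apply: subset_leq_card; apply/subsetP => x /c_max.
    rewrite c1 c2 leqn0 addn_eq0 => /andP[/eqP x1 /eqP x2].
    rewrite in_set1 [x]surjective_pairing [c]surjective_pairing.
    by apply/eqP; congr (_, _); apply: val_inj; rewrite /= ?x1 ?x2 ?c1 ?c2.
  by rewrite card_ferrers cards1 leqNgt n_gt1.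
exists (inord (size p), ord0); rewrite in_set /= inordK ?ltnS ?size_intpart //.
rewrite nth_default // ltnn negb_and -!ltnNge c2 orbT; split=> // -[i j] /=.
move=> le_i; rewrite leqn0 => /eqP/(@val_inj _ _ _ j ord0)-> neq_i.
rewrite in_set /=; apply: (allP (intpart_pos p)); rewrite mem_nth // ltn_neqAle le_i andbT.
apply: contraNneq neq_i => eq_i.
by apply/eqP; congr (_, _); apply: val_inj; rewrite /= inordK -?eq_i.
Qed.

Lemma dim_loc_gt0 p : 1 < n -> 0 < dim_loc p.
Proof.
move=> /(exists_adj p)[q pq].
have := pq; rewrite adjE => /moveP[c [a [cp ap defq]]].
have [cR aA pca] := move_admissible p q c a cp ap defq.
apply: leq_trans (star_cap_le_dim p); apply: (@leq_trans #|Amax p c|).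
  by apply/card_gt0P; exists a; rewrite in_set aA.
exact: (leq_bigmax_cond c).
Qed.

End Diagrams.

Theorem corollary3p5 (n : nat) (hn : 2 <= n) :
  [/\ L 1 n = [set: intpart n] :\: Lge 2 n,
      forall r : nat, 2 <= r ->
        Lge r n = [set p : intpart n | (r <= star_cap p) || (r <= top_cap p)],
      forall r : nat, 2 <= r -> L r n = Lge r n :\: Lge r.+1 n
    & forall r : nat, 1 <= r ->
        L r n =
        [set p : intpart n | maxn 1 (maxn (star_cap p) (top_cap p)) == r]].
Proof.
split=> [|r r_ge2|r r_ge2|r r_ge1]; apply/setP => p; rewrite !inE.
- by rewrite -leqNgt eqn_leq dim_loc_gt0 // !andbT.
- by rewrite dim_locE leq_max.
- by rewrite -leqNgt eqn_leq.
by rewrite -dim_locE (maxn_idPr _) // dim_loc_gt0.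
Qed.
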